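(* If $\mathcal{B}$ is an eulerian building set, then there is a polynomial $\Phi_{\mathcal{B}}(\mathbf{c},\mathbf{d})$ in the noncommuting variables $\mathbf{c}=\mathbf{a}+\mathbf{b}$ and $\mathbf{d}=\mathbf{a}\mathbf{b}+\mathbf{b}\mathbf{a}$ (the $\mathbf{c}\mathbf{d}$-index of $\mathcal{B}$) such that $\Psi_{\mathcal{B}}(\mathbf{a},\mathbf{b})=\Phi_{\mathcal{B}}(\mathbf{c},\mathbf{d})$.
   Context: A building set on a finite set $X$ is a collection $\mathcal{B}$ of nonempty subsets of $X$ such that (B1) if $S,S'\in\mathcal{B}$ and $S\cap S'\neq\emptyset$ then $S\cup S'\in\mathcal{B}$, and (B2) $\{i\}\in\mathcal{B}$ for all $i\in X$; its rank is $n=|X|$. Restriction: $\mathcal{B}|_I=\{S\in\mathcal{B}:S\subset I\}$; discrete means only singletons. For a composition $\alpha=(a_1,\dots,a_k)\models n$, $k(\alpha)=k$, $\zeta_\alpha(\mathcal{B})$ is the number of ordered decompositions $X=J_1\sqcup\dots\sqcup J_k$ with $|J_i|=a_i$ and each $\mathcal{B}|_{J_i}$ discrete, and $S(\alpha)=\{a_1,a_1+a_2,\dots,a_1+\dots+a_{k-1}\}\subset[n-1]$; $\beta\preceq\alpha$ means $S(\beta)\subset S(\alpha)$. Let $u_\alpha=u_{\alpha,1}\cdots u_{\alpha,n-1}$ be the word in noncommuting variables $\mathbf{a},\mathbf{b}$ with $u_{\alpha,i}=\mathbf{b}$ if $i\in S(\alpha)$ and $\mathbf{a}$ otherwise. The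 flag $h$-vector is $\eta_\alpha(\mathcal{B})=\sum_{\beta\preceq\alpha}(-1)^{k(\alpha)-k(\beta)}\zeta_\beta(\mathcal{B})$, and the $\mathbf{a}\mathbf{b}$-index is $\Psi_{\mathcal{B}}(\mathbf{a},\mathbf{b})=\sum_{\alpha\models n}\eta_\alpha(\mathcal{B})u_\alpha\in\mathbb{Q}\langle\mathbf{a},\mathbf{b}\rangle$. Let $\zeta^{-1}(\mathcal{B}_\emptyset)=1$ and, for $X\ne\emptyset$, $\zeta^{-1}(\mathcal{B}_X)=\sum_{k\ge1}(-1)^kN_k$, where $N_k$ is the number of ordered decompositions $X=J_1\sqcup\dots\sqcup J_k$ into nonempty sets with each $\mathcal{B}_X|_{J_i}$ discrete. A building set $\mathcal{B}_X$ is eulerian if for every $J\subset X$, either $\mathcal{B}_X|_J$ is discrete or $\zeta^{-1}(\mathcal{B}_X|_J)=0$. *)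

(* Defs.v *)
(* Mathematical Components, with the monoid algebras of multinomials. *)
From HB Require Import structures.
From mathcomp Require Import all_boot all_order all_algebra.
From mathcomp Require Import finmap.
From mathcomp.multinomials Require Import monalg.

Set Implicit Arguments.
Unset Strict Implicit.
Unset Printing Implicit Defensive.

Import GRing.Theory.
Local Open Scope ring_scope.

Section Compositions.
Local Open Scope nat_scope.

Definition is_composition (n : nat) (a : seq nat) : bool :=
  all (fun i => 0 < i) a && (sumn a == n).

(* A composition of n has at most n parts, each at most n; see
   mem_compositions and uniq_compositions. *)
Definition compositions (n : nat) : seq (seq nat) :=
  [seq a <- [seq [seq val i | i <- val t]
               | k <- iota 0 n.+1, t <- enum {: k.-tuple 'I_n.+1}]
     | is_composition n a].

Definition descents (a : seq nat) : seq nat :=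
  [seq sumn (take i a) | i <- iota 1 (size a).-1].

Definition refines (b a : seq nat) : bool :=
  all (mem (descents a)) (descents b).

Lemma size_composition n a : is_composition n a -> size a <= n.
Proof.
case/andP=> + /eqP <-; elim: a => //= x a IH /andP[x0 /IH].
by move=> h; rewrite -add1n leq_add.
Qed.

Lemma mem_compositions n a : (a \in compositions n) = is_composition n a.
Proof.
rewrite mem_filter; case: (boolP (is_composition n a)) => // ca.
rewrite andTb.
have sa := size_composition ca.
have le_n i : i \in a -> i < n.+1.
  case/andP: ca => _ /eqP <- ia; rewrite ltnS sumnE.
  by rewrite (big_rem i ia) /= leq_addr.
have szt : size [seq inord i : 'I_n.+1 | i <- a] == size a by rewrite size_map.
apply/allpairsPdep; exists (size a), (Tuple szt).
split; [by rewrite mem_iota | by rewrite mem_enum |].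
rewrite /= -map_comp -[LHS]map_id; apply/eq_in_map => i ia /=.
by rewrite inordK // le_n.
Qed.

Lemma uniq_compositions n : uniq (compositions n).
Proof.
apply: filter_uniq; apply: allpairs_uniq_dep; first exact: iota_uniq.
  by move=> k _; exact: enum_uniq.
move=> [k t] [l u] _ _ /= e.
have kl : k = l.
  by move: (congr1 size e); rewrite !size_map !size_tuple.
subst l; congr existT; apply: val_inj.
exact: (inj_map val_inj) e.
Qed.

End Compositions.

Section BuildingSets.
Variable T : finType.
Implicit Types (X I : {set T}) (B : {set {set T}}).

(* The ground set is a subset X of T, so that the restriction of B to I is
   again a building set in the same sense, on the ground set I. *)
Definition building_set X B : Prop :=
  [/\ forall S, S \in B -> S != set0 /\ S \subset X,
      forall S S', S \in B -> S' \in B -> S :&: S' != set0 -> S :|: S' \in B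
    & forall i, i \in X -> [set i] \in B].

Definition restriction B I : {set {set T}} := [set S in B | S \subset I].

Definition discrete B : bool := [forall S in B, #|S| == 1%N].

(* Ordered decompositions of X into k pairwise disjoint, possibly empty sets
   on which B restricts to a discrete building set. *)
Definition decompositions (k : nat) X B : {set {ffun 'I_k -> {set T}}} :=
  [set J : {ffun 'I_k -> {set T}} |
    [&& \bigcup_i J i == X,
        [forall i, forall j, (i != j) ==> [disjoint J i & J j]]
      & [forall i, discrete (restriction B (J i))]]].

Definition zeta (a : seq nat) X B : nat :=
  #|[set J in decompositions (size a) X B
       | [forall i, #|J i| == nth 0%N a i]]|.

Definition nonempty_decompositions (k : nat) X B :
    {set {ffun 'I_k -> {set T}}} :=
  [set J in decompositions k X B | [forall i, J i != set0]].

(* The terms with k > #|X| vanish (nonempty_decompositions_gt), so the sum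
   over all k >= 1 is truncated at #|X|. *)
Definition zeta_inv X B : int :=
  if X == set0 then 1
  else \sum_(1 <= k < #|X|.+1) (-1) ^+ k * #|nonempty_decompositions k X B|%:Z.

Lemma nonempty_decompositions_gt k X B :
  (#|X| < k)%N -> nonempty_decompositions k X B = set0.
Proof.
move=> Xk; apply/setP => J; rewrite !inE; apply/negbTE/negP.
case/andP=> /and3P[/eqP JX /forallP dJ _] /forallP J0.
have pJ i : exists x, x \in J i by apply/set0Pn; exact: J0.
pose f i := xchoose (pJ i).
have fJ i : f i \in J i by exact: xchooseP.
have injf : injective f.
  move=> i j fij; apply/eqP/negPn/negP => ij.
  have /forallP/(_ j)/implyP/(_ ij)/pred0P/(_ (f i)) := dJ i.
  by rewrite /= fJ fij fJ.
move: Xk; rewrite ltnNge => /negP; apply.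
rewrite -[k in (k <= _)%N]card_ord -(card_imset _ injf).
apply: subset_leq_card; apply/subsetP => _ /imsetP[i _ ->].
by rewrite -JX; apply/bigcupP; exists i.
Qed.

Definition eulerian X B : Prop :=
  forall J : {set T}, J \subset X ->
    discrete (restriction B J) \/ zeta_inv J (restriction B J) = 0.

Definition flag_h (a : seq nat) X B : int :=
  \sum_(b <- compositions #|X| | refines b a)
    (-1) ^+ (size a - size b) * (zeta b X B)%:Z.

End BuildingSets.

(* The free associative Q-algebra on two generators. *)
Notation ncpoly2 := {malg rat[{fmonom bool}]}.

Definition ncvar (v : bool) : ncpoly2 := << fmu v >>.

Definition va : ncpoly2 := ncvar false.
Definition vb : ncpoly2 := ncvar true.

(* The value of the noncommutative polynomial P when ncvar false and ncvar true
   are replaced by x and y. *)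
Definition nceval (A : lalgType rat) (x y : A) (P : ncpoly2) : A :=
  mmap (in_alg A)
       (fun m : {fmonom bool} => \prod_(v <- m) (if v then y else x)) P.

(* The word u of length n - 1 attached to the composition a of n. *)
Definition ab_word (n : nat) (a : seq nat) : ncpoly2 :=
  \prod_(1 <= i < n) (if i \in descents a then vb else va).

Definition ab_index (T : finType) (X : {set T}) (B : {set {set T}}) : ncpoly2 :=
  \sum_(a <- compositions #|X|) (flag_h a X B)%:~R *: ab_word #|X| a.

(* Main.v *)
(* Write z(J) = 1 when B is discrete on J and 0 otherwise, and e = a - b.
   Expanding the flag h-vector in terms of zeta turns the ab-index into
     Psi_Y = \sum_(J nonempty, J \subset Y)
               z(J) e^(|J|-1) (1 if J = Y, else b Psi_(Y \ J)).
   As 2 b = c - e, this reads (1 + Z) Psi = z' (2 + c Psi) for the convolution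
   over J \subset Y, where Z has values z(J) e^|J| and z' has values
   z(J) e^(|J|-1) with z'(set0) = 0. The eulerian condition says that the
   convolution inverse of z is (-1)^|J| z(J), so multiplying by 1 + Z^-1 leaves
   only even |J| on the left and odd |J| on the right, that is, only powers of
   e^2 = c^2 - 2 d. The resulting recursion shows by induction on |Y| that
   Psi_Y is a polynomial in c and d. *)
From HB Require Import structures.
Require Import Defs.
From mathcomp Require Import all_boot all_order all_algebra.
From mathcomp Require Import lra zify.
From mathcomp Require Import finmap.
From mathcomp.multinomials Require Import monalg.

Set Implicit Arguments.
Unset Strict Implicit.
Unset Printing Implicit Defensive.

Import GRing.Theory.
Local Open Scope ring_scope.

(** * Evaluation of noncommutative polynomials and the cd-recursion *)

Section NCEval.
Variables (A : lalgType rat) (x y : A).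

(** In an [lalgType] scalars move freely only through the left factor. They also move through the
    right one here, since left multiplication by [u] is additive and additive maps of rational
    vector spaces are linear. *)
Lemma rat_scalerAr (k : rat) (u v : A) : k *: (u * v) = u * (k *: v).
Proof. by apply/esym/(rat_linear (f := *%R u)) => s t; rewrite mulrBr. Qed.

Let word_eval (m : {fmonom bool}) : A := \prod_(v <- m) (if v then y else x).

Fact word_eval_mmorphism : mmorphism word_eval.
Proof.
by split=> [m1 m2|]; rewrite /word_eval ?fm1 ?big_nil // fmM big_cat.
Qed.

HB.instance Definition _ :=
  monalg.isMultiplicative.Build {fmonom bool} A word_eval word_eval_mmorphism.

(** The subalgebra of [A] generated by [x] and [y]; the theorem places the ab-index in the one
    generated by [a + b] and [a b + b a]. *)
Definition nceval_image (p : A) : Prop := exists P, p = nceval x y P.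

Lemma nceval_imageD p q :
  nceval_image p -> nceval_image q -> nceval_image (p + q).
Proof. by move=> [P ->] [Q ->]; exists (P + Q); rewrite /nceval mmapD. Qed.

Lemma nceval_imageM p q :
  nceval_image p -> nceval_image q -> nceval_image (p * q).
Proof.
move=> [P ->] [Q ->]; exists (P * Q).
(* Evaluation is multiplicative once scalars commute with the values of words, which is
   [rat_scalerAr]. *)
have [|hM _] := @commr_mmap_is_multiplicative _ _ _ (in_alg A) word_eval.
  by move=> g m m'; rewrite /GRing.comm mulr_algl -rat_scalerAr mulr1.
exact/esym/hM.
Qed.

Lemma nceval_imageZ k p : nceval_image p -> nceval_image (k *: p).
Proof.
move=> [P ->]; exists (k *: P).
by rewrite /nceval (mmapZ (f := in_alg A) (h := word_eval)) mulr_algl.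
Qed.

Lemma nceval_image1 : nceval_image 1.
Proof. by exists 1; rewrite /nceval (mmap1 (f := in_alg A) (h :=
  word_eval)). Qed.

Lemma nceval_image_var v : nceval_image (if v then y else x).
Proof.
exists (ncvar v); rewrite /nceval /ncvar (mmapU (f := in_alg A)).
by rewrite /= scale1r mul1r fmU big_seq1.
Qed.

Lemma nceval_image0 : nceval_image 0.
Proof. by rewrite -(scale0r 1); apply/nceval_imageZ/nceval_image1. Qed.

Lemma nceval_imageX p n : nceval_image p -> nceval_image (p ^+ n).
Proof.
move=> hp; elim: n => [|n IH]; first exact: nceval_image1.
by rewrite exprS; apply: nceval_imageM.
Qed.

Lemma nceval_image_sum (I : Type) (r : seq I) (P : pred I) (F : I -> A) :
  (forall i, P i -> nceval_image (F i)) ->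
    nceval_image (\sum_(i <- r | P i) F i).
Proof. by apply: big_ind; [exact: nceval_image0 | exact: nceval_imageD]. Qed.

End NCEval.

(** * Convolution over subsets *)

Section SubsetConvolution.
Variable T : finType.
Implicit Types J K L Y : {set T}.

(** Both sides run over the disjoint pairs [J], [K] inside [Y], with [L] as their union. This is the
    reindexing behind associativity of convolution. *)
Lemma sum_subset_pair (V : nmodType) Y (F : {set T} -> {set T} -> V) :
  \sum_(J : {set T} | J \subset Y) \sum_(K :
    {set T} | K \subset Y :\: J) F J K =
  \sum_(L : {set T} | L \subset Y) \sum_(J :
    {set T} | J \subset L) F J (L :\: J).
Proof.
rewrite [RHS](exchange_big_dep (fun J : {set T} => J \subset Y)) /=; last first.
  by move=> L J LY JL; apply: subset_trans LY.
apply: eq_bigr => J JY.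
rewrite [RHS](reindex_onto (fun K : {set T} => J :|: K) (fun L => L :\: J));
  last first.
  by move=> L /andP[_ JL]; rewrite setDE setUIr setUCr setIT; apply/setUidPr.
apply: eq_big => [K|K].
  rewrite subsetD subsetUl andbT subUset JY /= setDUl setDv set0U.
  by rewrite (sameP setDidPl eqP).
by rewrite subsetD setDUl setDv set0U => /andP[_ /setDidPl ->].
Qed.

(** Toggling a fixed element [y] of [Y] pairs off subsets of opposite sign. *)
Lemma sum_sign_subset Y :
  Y != set0 -> \sum_(J : {set T} | J \subset Y) (-1) ^+ #|J| = 0 :> int.
Proof.
case/set0Pn=> y yY.
rewrite (bigID (fun J : {set T} => y \in J)) /=.
rewrite (reindex_onto (fun J : {set T} => y |: J) (fun J => J :\ y));
  last first.
  by move=> J /andP[_ yJ]; rewrite setD1K.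
rewrite -[X in X + _]opprK -sumrN.
rewrite [X in - X + _](eq_big (fun J => (J \subset Y) && (y \notin J))
  (fun J => (-1) ^+ #|J|)) ?addNr //.
  move=> J; rewrite subUset sub1set yY setU11 /= andbT.
  case: (J \subset Y) => //=; case: (boolP (y \in J)) => yJ /=.
    by apply/negbTE/eqP => h; move: yJ; rewrite -h !inE eqxx.
  by rewrite setU1K ?eqxx.
move=> J /andP[/andP[_ _] /eqP h].
have yJ : y \notin J by rewrite -h !inE eqxx.
by rewrite cardsU1 yJ exprS mulN1r opprK.
Qed.

End SubsetConvolution.

(** * The recursion for the ab-index and its even part *)

Section CDRecursion.
Variables (T : finType) (A : lalgType rat) (X : {set T}).
Variables (z : {set T} -> rat) (x y : A) (Psi : {set T} -> A).
Implicit Types J K L Y : {set T}.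

Let e := x - y.
Let c := x + y.
Let d := x * y + y * x.

Hypothesis z0 : z set0 = 1.
Hypothesis z_odd : forall Y, Y \subset X -> Y != set0 ->
  \sum_(J : {set T} | J \subset Y) (-1) ^+ #|J| * z J * z (Y :\: J) = 0.
Hypothesis Psi_rec : forall Y, Y \subset X ->
  Psi Y = \sum_(J : {set T} | (J \subset Y) && (J != set0))
    z J *: (e ^+ #|J|.-1 * ((Y == J)%:R + y * Psi (Y :\: J))).

(** The exponent function [p] is [id] or [predn], as both [e^|J|] and [e^(|J|-1)] occur. *)
Let act (p : nat -> nat) (f : {set T} -> rat) (m : {set T} -> A) Y :=
  \sum_(J : {set T} | J \subset Y) f J *: (e ^+ p #|J| * m (Y :\: J)).

Let conv (f g : {set T} -> rat) Y := \sum_(J :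
  {set T} | J \subset Y) f J * g (Y :\: J).

(** Powers of [e] add along disjoint unions, so acting twice is acting by the convolution. The
    condition on [p] is asked only where [g K] is nonzero, because for [predn] it breaks down at
    [K = set0]. *)
Lemma act_conv p f g m Y :
  (forall J K, K \subset Y :\: J -> g K != 0 ->
    p #|J :|: K| = (#|J| + p #|K|)%N) ->
  act id f (act p g m) Y = act p (conv f g) m Y.
Proof.
move=> hp.
pose F J K := (f J * g K) *: (e ^+ p #|J :|: K| * m (Y :\: J :\: K)).
transitivity (\sum_(J : {set T} | J \subset Y) \sum_(K :
  {set T} | K \subset Y :\: J) F J K).
  apply: eq_bigr => J JY; rewrite mulr_sumr scaler_sumr; apply: eq_bigr => K KY.
  rewrite /F -rat_scalerAr scalerA mulrA -exprD.
  have [->|gK] := eqVneq (g K) 0; first by rewrite mulr0 !scale0r.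
  by rewrite hp.
rewrite sum_subset_pair; apply: eq_bigr => L LY; rewrite /conv scaler_suml.
apply: eq_bigr => J JL; rewrite /F setDDl.
by have -> : J :|: (L :\: J) = L by rewrite setDE setUIr setUCr setIT;
  apply/setUidPr.
Qed.

Let delta J : rat := (J == set0)%:R.
(** The constant 2 in [2 + c Psi] is a multiple of the convolution unit and so lives at the empty
    set. *)
Let G J : A := (J == set0)%:R *+ 2 + c * Psi J.

Lemma act_split p f m Y :
  act p f m Y = f set0 *: (e ^+ p 0%N * m Y) +
    \sum_(J : {set T} | (J \subset Y) && (J != set0)) f J *: (e ^+ p #|J| * m
      (Y :\: J)).
Proof. by rewrite /act (bigD1 set0) ?sub0set //= cards0 setD0. Qed.

Lemma conv_delta_l f g Y : conv (fun J => delta J + f J) g Y = g Y + conv f g Y.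
Proof.
rewrite /conv; under eq_bigr do rewrite mulrDl.
rewrite big_split /=; congr (_ + _).
rewrite (bigD1 set0) ?sub0set //= /delta eqxx mul1r setD0 big1 ?addr0 // => J.
by case/andP=> _ /negbTE ->; rewrite mul0r.
Qed.

Lemma conv_delta_r f s Y : conv f (fun J => s * delta J) Y = s * f Y.
Proof.
rewrite /conv (bigD1 Y) //= setDv /delta eqxx mulr1 mulrC big1 ?addr0 // => J.
case/andP=> JY nJ; rewrite setD_eq0 -[Y \subset J]andTb -JY -eqEsubset (negbTE
  nJ).
by rewrite !mulr0.
Qed.

Lemma convDr f g h Y : conv f (fun J => g J + h J) Y = conv f g Y + conv f h Y.
Proof. by rewrite -big_split; apply: eq_bigr => J _; rewrite mulrDr. Qed.

Let sz J : rat := (-1) ^+ #|J| * z J.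

(** Together with [z0], [z_odd] says that [sz] is a convolution inverse of [z] on subsets of [X]. *)
Lemma conv_sign Y : Y \subset X -> conv sz z Y = delta Y.
Proof.
move=> YX; rewrite /conv /delta; have [->|Y0] := eqVneq Y set0;
  last exact: z_odd.
rewrite (bigD1 set0) //= /sz cards0 setD0 z0 !mulr1 big1 ?addr0 // => J.
by rewrite subset0 => /andP[->].
Qed.

(** Doubling [Psi_rec] produces [2 y = c - e]; the terms with the extra factor [e] move to the left
    and raise the exponent from [|J| - 1] to [|J|]. *)
Lemma Psi_act Y : Y \subset X ->
  act id (fun J => delta J + z J) Psi Y =
  act predn (fun J => z J + (-1) * delta J) G Y.
Proof.
(* At [J = set0] the coefficient is [1 + 1] on the left and [1 - 1] on the right. The remaining
   [2 Psi Y] is expanded by the recursion. *)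
move=> YX; rewrite !act_split /delta eqxx z0 mulr1 subrr scale0r add0r expr0
  mul1r.
have {1}-> : (1 + 1 : rat) = 2%:R by [].
rewrite (Psi_rec YX) scaler_sumr -big_split /=;
  apply: eq_bigr => J /andP[JY J0].
have -> : e ^+ #|J| = e ^+ #|J|.-1 * e by rewrite -exprSr prednK // card_gt0.
rewrite (negbTE J0) add0r mulr0 addr0 scalerA mulrC -scalerA -scalerDr -mulrA.
rewrite rat_scalerAr -mulrDr /G setD_eq0 eqEsubset JY andbT.
rewrite scaler_nat mulrnDl -addrA -mulrnAl -mulrDl.
congr (_ *: (_ * (_ + _ * _))).
by rewrite /e /c [x - y]addrC addrA mulr2n addrK addrC.
Qed.

(* The convolution inverse of [z] is [sz], so multiplying [Psi_act] by
   [delta + sz] cancels the odd powers of [e]. *)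
Lemma Psi_parity Y : Y \subset X ->
  act id (fun J => delta J + (~~ odd #|J|)%:R * z J) Psi Y =
  act predn (fun J => (odd #|J|)%:R * z J) G Y.
Proof.
move=> YX.
have E : act id (fun J => delta J + sz J)
           (act id (fun J => delta J + z J) Psi) Y =
         act id (fun J => delta J + sz J)
           (act predn (fun J => z J + (-1) * delta J) G) Y.
  apply: eq_bigr => J JY; rewrite Psi_act //.
  by apply: subset_trans YX; rewrite subDset subsetUr.
rewrite act_conv in E; last first.
  by move=> J K; rewrite subsetD => /andP[_ KJ] _; rewrite cardsU
    disjoint_setI0 ?cards0 ?subn0 // disjoint_sym.
rewrite act_conv in E; last first.
  move=> J K; rewrite subsetD => /andP[_ KJ] gK; rewrite cardsU
    disjoint_setI0 ?cards0 ?subn0 1?disjoint_sym //.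
  (* The coefficient [z - delta] vanishes at the empty set, so the predecessor of [|K|] is not
     truncated. *)
  have K0 : K != set0.
    by apply: contraNneq gK => ->; rewrite z0 /delta eqxx mulr1 subrr.
  by rewrite -[#|K|]prednK ?card_gt0 // addnS.
have half (u v : A) : 2%:R *: u = 2%:R *: v -> u = v by apply: scalerI.
apply: half; rewrite /act !scaler_sumr; move: E; rewrite /act.
(* On the left, [(delta + sz) * (delta + z) = 2 delta + z + sz], and [z + sz] is [2 z] on even sets
   and 0 on odd ones. *)
rewrite (eq_bigr (fun J => 2%:R *: ((delta J + (~~ odd #|J|)%:R * z J) *:
   (e ^+ #|J| * Psi (Y :\: J))))); last first.
  move=> J JY; rewrite scalerA; congr (_ *: _).
  rewrite conv_delta_l convDr conv_sign ?(subset_trans JY) //.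
  have -> : conv sz delta J = sz J.
    rewrite -[RHS]mul1r -conv_delta_r.
    by apply: eq_bigr => K _; rewrite mul1r.
  rewrite /sz -signr_odd; case: (odd _) => /=; lra.
(* On the right, [(delta + sz) * (z - delta) = z - sz], which is [2 z] on odd sets and 0 on even
   ones. *)
move=> ->; apply: eq_bigr => J JY; rewrite scalerA; congr (_ *: _).
rewrite conv_delta_l convDr conv_sign ?(subset_trans JY) // conv_delta_r.
by rewrite /sz -signr_odd; case: (odd _) => /=; lra.
Qed.

(** Strong induction on [|Y|]. In [Psi_parity] the term at [set0] is [2 Psi Y] on the left and 0 on
    the right; every other nonzero term has an even power of [e] and a strictly smaller
    complement. *)
Lemma nceval_image_Psi Y : Y \subset X -> nceval_image c d (Psi Y).
Proof.
have hc : nceval_image c d c by exact: (nceval_image_var c d false).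
have he2 : nceval_image c d (e ^+ 2).
  have -> : e ^+ 2 = c * c + (- 2%:R) *: d.
    rewrite /e /c /d scaleNr scaler_nat expr2 mulrBl !mulrBr !mulrDl !mulrDr.
    rewrite mulr2n [y * x + y * y]addrC [X in _ = X + _]addrACA [in RHS]opprD
      [RHS]addrA addrK.
    by rewrite opprB [LHS]addrACA -opprD.
  apply: nceval_imageD; first exact: nceval_imageM.
  exact/nceval_imageZ/(nceval_image_var c d true).
have heven k : ~~ odd k -> nceval_image c d (e ^+ k).
  by move=> k2; rewrite -[k]odd_double_half (negbTE k2) -mul2n exprM;
    apply: nceval_imageX.
have [n] := ubnP #|Y|; elim: n Y => // n IH Y; rewrite ltnS => Yn YX.
have IH' J : J \subset Y -> J != set0 -> nceval_image c d (Psi (Y :\: J)).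
  move=> JY J0; apply: IH; last by apply: subset_trans YX;
    rewrite subDset subsetUr.
  apply: leq_trans Yn; rewrite cardsD (setIidPr JY) ltn_subrL card_gt0 J0 /=.
  by apply: leq_trans (subset_leq_card JY); rewrite card_gt0.
have hG J : J \subset Y -> J != set0 -> nceval_image c d (G (Y :\: J)).
  move=> JY J0; apply: nceval_imageD; last exact/nceval_imageM/IH'.
  rewrite -scaler_nat; apply: nceval_imageZ.
  by case: (_ == _); [exact: nceval_image1 | exact: nceval_image0].
have := Psi_parity YX; rewrite !act_split /delta eqxx cards0 z0 !mulr1 /=.
rewrite scale0r add0r expr0 mul1r => /(canRL (addrK _)) E.
have -> : Psi Y = 2%:R^-1 *: ((1 + 1) *: Psi Y) by rewrite scalerA mulVf
  ?scale1r.
rewrite E; apply: nceval_imageZ; apply: nceval_imageD; last rewrite -scaleN1r.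
  apply: nceval_image_sum => J /andP[JY J0].
  case: (boolP (odd _)) => oJ; last by rewrite mul0r scale0r;
    exact: nceval_image0.
  apply/nceval_imageZ/nceval_imageM/hG => //; apply: heven.
  by rewrite -oddS prednK ?card_gt0 // oJ.
apply: nceval_imageZ; apply: nceval_image_sum => J /andP[JY J0].
rewrite (negbTE J0) add0r.
case: (boolP (odd _)) => oJ; first by rewrite mul0r scale0r;
  exact: nceval_image0.
by apply/nceval_imageZ/nceval_imageM/IH' => //; apply: heven.
Qed.

End CDRecursion.

(** * Counting decompositions *)

Section Counting.
Variables (T : finType) (B : {set {set T}}).
Implicit Types (Y J K : {set T}) (P : nat -> pred {set T}).

Definition discrete_on J := discrete (restriction B J).

Lemma decompositionsP k Y (D : {ffun 'I_k -> {set T}}) :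
  reflect [/\ \bigcup_i D i = Y, forall i j, i != j -> [disjoint D i & D j]
            & forall i, discrete_on (D i)]
          (D \in decompositions k Y B).
Proof.
rewrite inE; apply: (iffP and3P) =>
  [[/eqP h1 /forallP h2 /forallP h3]|[h1 h2 h3]].
  by split=> // i j ij; move/forallP/(_ j)/implyP: (h2 i); apply.
split; [exact/eqP | | exact/forallP].
by apply/forallP => i; apply/forallP => j; apply/implyP; exact: h2.
Qed.

Definition ffun_cons k J (D : {ffun 'I_k -> {set T}}) : {ffun 'I_k.+1 ->
  {set T}} :=
  [ffun i => if unlift ord0 i is Some j then D j else J].

Lemma ffun_cons0 k J (D : {ffun 'I_k -> {set T}}) : ffun_cons J D ord0 = J.
Proof. by rewrite ffunE unlift_none. Qed.

Lemma ffun_consS k J (D : {ffun 'I_k -> {set T}}) i :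
  ffun_cons J D (lift ord0 i) = D i.
Proof. by rewrite ffunE liftK. Qed.

(** The first block is disjoint from the others exactly when these have union [Y :\: J], so
    disjointness from [J] is absorbed into the new ground set. *)
Lemma decompositions_cons k Y J (D : {ffun 'I_k -> {set T}}) :
  (ffun_cons J D \in decompositions k.+1 Y B) =
  [&& J \subset Y, discrete_on J & D \in decompositions k (Y :\: J) B].
Proof.
have cupE : \bigcup_i ffun_cons J D i = J :|: \bigcup_i D i.
  rewrite big_ord_recl ffun_cons0; congr (_ :|: _).
  by apply: eq_bigr => i _; rewrite ffun_consS.
apply/decompositionsP/and3P => [[]|[JY dJ /decompositionsP[DY disj dD]]].
  rewrite cupE => DY disj dD; split.
  - by rewrite -DY subsetUl.
  - by rewrite -(ffun_cons0 J D).
  apply/decompositionsP; split=> [|i j ij|i].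
  - rewrite -DY setDUl setDv set0U; apply/esym/setDidPl.
    rewrite disjoint_sym; apply/bigcup_disjointP => i _.
    by rewrite -(ffun_cons0 J D) -(ffun_consS J D) disj.
  - by rewrite -!(ffun_consS J D) disj // (inj_eq lift_inj).
  - by rewrite -(ffun_consS J D).
have DJ i : [disjoint J & D i].
  have : D i \subset Y :\: J by rewrite -DY; apply: bigcup_sup.
  by rewrite subsetD disjoint_sym => /andP[].
split=> [|i j|i].
- by rewrite cupE DY setDE setUIr setUCr setIT; apply/setUidPr.
- case: (unliftP ord0 i) => [i'|] ->; case: (unliftP ord0 j) => [j'|] -> ij.
  + by rewrite !ffun_consS disj // -(inj_eq (@lift_inj _ ord0)).
  + by rewrite ffun_cons0 ffun_consS disjoint_sym.
  + by rewrite ffun_cons0 ffun_consS.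
  + by rewrite eqxx in ij.
by case: (unliftP ord0 i) => [i'|] ->; rewrite ?ffun_consS ?ffun_cons0.
Qed.

(** A common form of [zeta], where [P i] fixes the size of block [i], and of the nonempty
    decompositions, so that the first block is split off once for both. *)
Definition count_decompositions k P Y : nat :=
  #|[set D in decompositions k Y B | [forall i, P (val i) (D i)]]|.

Lemma count_decompositions0 P Y : count_decompositions 0 P Y = (Y == set0).
Proof.
have D0 (D : {ffun 'I_0 -> {set T}}) : (D \in [set D in decompositions 0 Y B |
    [forall i, P (val i) (D i)]]) = (Y == set0).
  rewrite inE andbC; have -> /= :
    [forall i, P (val i) (D i)] by apply/forallP=> -[].
  apply/decompositionsP/eqP => [[<- _ _]|->]; first by rewrite big_ord0.
  by split=> [|[]|[]] //; rewrite big_ord0.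
rewrite /count_decompositions; have [Y0|Y0] := eqVneq Y set0.
  rewrite (eq_card (B := predT)) => [|D]; last by rewrite D0 Y0 eqxx.
  by rewrite card_ffun card_ord expn0.
by apply: eq_card0 => D; rewrite D0 (negbTE Y0).
Qed.

Lemma count_decompositionsS k P Y :
  count_decompositions k.+1 P Y =
  \sum_(J : {set T} | (J \subset Y) && (discrete_on J && P 0 J))
    count_decompositions k (fun i => P i.+1) (Y :\: J).
Proof.
rewrite /count_decompositions -sum1_card.
under [RHS]eq_bigr do rewrite -sum1_card.
rewrite pair_big_dep /=.
(* Decompositions into [k.+1] blocks correspond to pairs of a first block and a tail. *)
pose split (D : {ffun 'I_k.+1 -> {set T}}) := (D ord0, [ffun i =>
  D (lift ord0 i)]).
have bij : bijective (fun p : {set T} * {ffun 'I_k -> {set T}} =>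
  ffun_cons p.1 p.2).
  exists split => [[J D]|D].
    by rewrite /split ffun_cons0; congr (_, _); apply/ffunP => i;
      rewrite !ffunE liftK.
  apply/ffunP => i; case: (unliftP ord0 i) => [j|] ->.
    by rewrite ffun_consS ffunE.
  by rewrite ffun_cons0.
rewrite (reindex _ (onW_bij _ bij)); apply: eq_bigl => -[J D] /=.
rewrite in_set decompositions_cons [in RHS]in_set.
have -> : [forall i, P (val i) (ffun_cons J D i)] =
          P 0%N J && [forall i : 'I_k, P (val i).+1 (D i)].
  apply/forallP/andP => [h|[h0 /forallP h] i].
    split; first by have := h ord0; rewrite ffun_cons0.
    by apply/forallP => i; have := h (lift ord0 i); rewrite ffun_consS.
  by case: (unliftP ord0 i) => [j|] ->; rewrite ?ffun_cons0 ?ffun_consS //;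
    apply: h.
by rewrite -!andbA; do !bool_congr.
Qed.

Lemma zeta_nil Y : zeta [::] Y B = (Y == set0).
Proof. exact: (count_decompositions0 (fun i J => #|J| == nth 0%N [::] i)). Qed.

Lemma zeta_cons x s Y : zeta (x :: s) Y B =
  \sum_(J : {set T} | (J \subset Y) && (discrete_on J && (#|J| == x)))
    zeta s (Y :\: J) B.
Proof.
exact: (count_decompositionsS _ (fun i J => #|J| == nth 0%N (x :: s) i)).
Qed.

Lemma card_nonempty_decompositions0 Y :
  #|nonempty_decompositions 0 Y B| = (Y == set0).
Proof. exact: (count_decompositions0 (fun i J => J != set0)). Qed.

Lemma card_nonempty_decompositionsS k Y :
  #|nonempty_decompositions k.+1 Y B| =
  \sum_(J : {set T} | (J \subset Y) && (discrete_on J && (J != set0)))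
    #|nonempty_decompositions k (Y :\: J) B|.
Proof. exact: (count_decompositionsS _ (fun i J => J != set0)). Qed.

(** The range no longer depends on [Y], which allows sums over subsets to be exchanged with it; the
    term [k = 0] accounts for the value 1 at the empty set. *)
Lemma zeta_inv_sum m Y : (#|Y| <= m)%N ->
  zeta_inv Y B = \sum_(0 <= k < m.+1) (-1) ^+ k * #|nonempty_decompositions k Y
    B|%:Z.
Proof.
move=> Ym; rewrite (big_cat_nat (n := #|Y|.+1)) //=.
rewrite [X in _ = _ + X]big_nat_cond [X in _ = _ + X]big1 ?addr0; last first.
  by move=> k /andP[/andP[Yk _] _];
    rewrite nonempty_decompositions_gt ?cards0 ?mulr0.
rewrite big_nat_recl //= card_nonempty_decompositions0 expr0 mul1r /zeta_inv.
have [->|Y0] := eqVneq Y set0; first by rewrite cards0 big_geq ?addr0.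
by rewrite add0r big_add1.
Qed.

Lemma discrete_onS J K : J \subset K -> discrete_on K -> discrete_on J.
Proof.
move=> JK /forallP dK; apply/forallP => S; apply/implyP;
  rewrite inE => /andP[SB SJ].
by move/implyP: (dK S); apply; rewrite inE SB (subset_trans SJ).
Qed.

Hypothesis B0 : set0 \notin B.

Lemma discrete_on0 : discrete_on set0.
Proof.
apply/forallP => S; apply/implyP; rewrite inE subset0 => /andP[SB /eqP S0].
by rewrite S0 (negbTE B0) in SB.
Qed.

(** Removing the first block of a nonempty decomposition flips the sign, so [zeta_inv] is the
    convolution inverse of the indicator of discreteness. *)
Lemma zeta_inv_conv Y : Y != set0 ->
  \sum_(J : {set T} | (J \subset Y) && discrete_on J) zeta_inv (Y :\: J) B = 0.
Proof.
move=> Y0; have Yn : #|Y| = #|Y|.-1.+1 by rewrite prednK // card_gt0.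
rewrite (bigD1 set0) ?sub0set ?discrete_on0 //= setD0.
rewrite (zeta_inv_sum (leqnn _)) Yn big_nat_recl //=.
rewrite card_nonempty_decompositions0 (negbTE Y0) mulr0 add0r.
under eq_bigr => k _.
  rewrite card_nonempty_decompositionsS exprS mulN1r mulNr -[Posz _]natz
    natr_sum mulr_sumr.
  over.
rewrite sumrN exchange_big /= addrC; apply/eqP; rewrite subr_eq0; apply/eqP.
apply: eq_big => [J|J /andP[/andP[JY _] J0]]; first by rewrite andbA.
under [RHS]eq_bigr do rewrite natz.
(* The bound is [|Y| - 1], valid because [J] is nonempty. *)
apply: zeta_inv_sum; rewrite cardsD (setIidPr JY).
by have := subset_leq_card JY; move: J0; rewrite -card_gt0; lia.
Qed.

Lemma decompositions_restriction k Y :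
  decompositions k Y (restriction B Y) = decompositions k Y B.
Proof.
apply/setP => D; rewrite !inE; case: eqP => //= DY; congr (_ && _).
apply: eq_forallb => i; congr discrete; apply/setP => S; rewrite !inE -andbA.
congr (_ && _); case: (boolP (S \subset D i)) => SD; last by rewrite andbF.
by rewrite andbT -DY (subset_trans SD) ?bigcup_sup.
Qed.

Lemma zeta_inv_restriction Y : zeta_inv Y (restriction B Y) = zeta_inv Y B.
Proof.
rewrite /zeta_inv; case: ifP => // _; apply: eq_bigr => k _.
by rewrite /nonempty_decompositions decompositions_restriction.
Qed.

(** Every subset of a discrete [Y] is discrete, so [zeta_inv] and the sign satisfy the same
    recursion, by [zeta_inv_conv] and [sum_sign_subset]. *)
Lemma zeta_inv_discrete Y : discrete_on Y -> zeta_inv Y B = (-1) ^+ #|Y|.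
Proof.
have [n] := ubnP #|Y|; elim: n Y => // n IH Y; rewrite ltnS => Yn dY.
have [->|Y0] := eqVneq Y set0; first by rewrite /zeta_inv eqxx cards0.
have := zeta_inv_conv Y0; have := sum_sign_subset Y0.
(* The factor [(-1)^|Y|] turns the sign of [J] into that of [Y :\: J]. *)
rewrite (bigD1 set0) ?sub0set //= cards0 expr0 =>
  /(congr1 ( *%R ((-1) ^+ #|Y|))).
rewrite mulr0 mulrDr mulr1 mulr_sumr => /eqP; rewrite addr_eq0 => /eqP ->.
rewrite (bigD1 set0) ?sub0set ?discrete_on0 //= setD0 => /eqP.
rewrite addr_eq0 => /eqP ->; congr (- _).
apply: eq_big => [J|J /andP[/andP[JY _] J0]].
  by case: (boolP (J \subset Y)) => //= JY; rewrite (discrete_onS JY).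
have YJ : Y :\: J \subset Y by apply: subsetDl.
have J1 := subset_leq_card JY.
rewrite IH ?(discrete_onS YJ) // cardsD (setIidPr JY).
  by rewrite -exprD -(subnK J1) addnK -addnA exprD addnn -mul2n exprM sqrrN
    !expr1n mulr1.
by move: J0; rewrite -card_gt0; lia.
Qed.

Lemma eulerian_zeta_inv X Y : eulerian X B -> Y \subset X ->
  zeta_inv Y B = (-1) ^+ #|Y| * (discrete_on Y)%:R.
Proof.
move=> eB YX; case: (boolP (discrete_on Y)) => dY.
  by rewrite zeta_inv_discrete ?mulr1.
case: (eB Y YX); first by move=> h; case/negP: dY.
by rewrite zeta_inv_restriction mulr0.
Qed.

(** This supplies [z_odd]: multiply [zeta_inv_conv] by [(-1)^|Y|], insert [eulerian_zeta_inv], and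
    use that [|Y| + |Y :\: J|] has the parity of [|J|]. *)
Lemma eulerian_odd X Y : eulerian X B -> Y \subset X -> Y != set0 ->
  \sum_(J : {set T} | J \subset Y)
    (-1) ^+ #|J| * (discrete_on J)%:R * (discrete_on (Y :\: J))%:R = 0 :> rat.
Proof.
move=> eB YX /zeta_inv_conv; rewrite big_mkcondr /= => h.
rewrite -[RHS](mulr0 ((-1) ^+ #|Y|)) -[X in _ * X]/(0%:~R) -h rmorph_sum
  mulr_sumr.
apply: eq_bigr => J JY; case: ifP => dJ; last by rewrite rmorph0 !mulr0 mul0r.
rewrite mulr1 (eulerian_zeta_inv eB) ?(subset_trans (subsetDl _ _)) //.
rewrite rmorphM rmorphXn /= rmorphN1 rmorph_nat mulrA; congr (_ * _).
rewrite cardsD (setIidPr JY) -exprD -(subnK (subset_leq_card JY)) addnK.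
by rewrite addnAC exprD addnn -mul2n exprM sqrrN !expr1n mul1r.
Qed.
End Counting.

(** * Compositions and words *)

Section Compositions.
Implicit Types (a b s D : seq nat) (n x : nat).

(** With prepending 1, this gives every composition of [n.+2] exactly once from those of [n.+1],
    according to whether 1 is a descent. *)
Definition incr_head a := (head 0%N a).+1 :: behead a.

Lemma compositions_cons n x s :
  (x :: s \in compositions n) = [&& 0 < x, x <= n & s \in compositions (n -
    x)]%N.
Proof.
rewrite !mem_compositions /is_composition /= -andbA; case: (0 < x)%N => //=.
rewrite andbCA; case: (all _ s) => /=; last by [].
by apply/eqP/andP => [<-|[xn /eqP ->]];
  [rewrite leq_addr addKn eqxx | rewrite subnKC].
Qed.

Lemma compositions0 : compositions 0 = [:: [::]].
Proof.
apply: perm_small_eq => //; apply: uniq_perm;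
  rewrite ?uniq_compositions // => -[|x s].
  by rewrite mem_compositions.
by rewrite compositions_cons inE andbC -ltnS; case: x => [|x]; rewrite ?andbF.
Qed.

Lemma sum_compositions_cons (V : nmodType) n (g : seq nat -> V) :
  \sum_(a <- compositions n.+1) g a =
  \sum_(1 <= x < n.+2) \sum_(s <- compositions (n.+1 - x)) g (x :: s).
Proof.
rewrite -(big_allpairs_dep (h := cons)); apply/perm_big/uniq_perm => [||a].
- exact: uniq_compositions.
- apply: allpairs_uniq_dep => [|x _|[x s] [y t] _ _ /= [-> ->] //].
    exact: iota_uniq.
  exact: uniq_compositions.
apply/idP/allpairsPdep => [|[x [s [+ sC ->]]]]; last first.
  by rewrite mem_index_iota compositions_cons sC andbT ltnS.
case: a => [|x s]; first by rewrite mem_compositions.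
rewrite compositions_cons => /and3P[x0 xn sC].
by exists x, s; rewrite mem_index_iota x0.
Qed.

Lemma sum_compositionsS (V : nmodType) n (g : seq nat -> V) :
  \sum_(a <- compositions n.+2) g a =
  \sum_(a <- compositions n.+1) (g (1%N :: a) + g (incr_head a)).
Proof.
rewrite big_split -(big_map (cons 1%N) xpredT) -(big_map incr_head xpredT)
  -big_cat /=.
apply/perm_big/uniq_perm => [||a]; first exact: uniq_compositions.
  rewrite cat_uniq !map_inj_in_uniq ?uniq_compositions /= ?andbT.
  (* The two families are disjoint: raising a positive first part never gives 1. *)
  - apply/hasPn => _ /mapP[a ca ->]; apply/mapP => -[b _ []].
    by case: a ca => [|[|x] s]; rewrite ?mem_compositions // compositions_cons.
  - by move=> [|x s] [|y t]; rewrite !mem_compositions //= => _ _ [-> ->].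
  - by move=> s t _ _ [].
rewrite mem_cat; apply/idP/orP => [|[]/mapP[b + ->]].
- case: a => [|[|[|x]] s];
  rewrite ?mem_compositions // -mem_compositions compositions_cons /=.
    by rewrite subSS subn0 => sC; left; apply: map_f.
  case/andP=> xn sC; right; apply/mapP; exists (x.+1 :: s) => //.
  by rewrite compositions_cons /= -ltnS xn.
- by rewrite compositions_cons subSS subn0.
- case: b => [|x s]; first by rewrite mem_compositions.
  by rewrite /incr_head /= !compositions_cons subSS => /and3P[_ xn ->];
    rewrite /= andbT.
Qed.

Lemma descents_cons x s : s != [::] ->
  descents (x :: s) = x :: [seq (x + i)%N | i <- descents s].
Proof.
case: s => // y s _; rewrite /descents /= addn0; congr (_ :: _).
by rewrite (iotaDl 1 1) -!map_comp; apply: eq_map => i.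
Qed.

Lemma descents_incr_head a : a != [::] ->
  descents (incr_head a) = [seq i.+1 | i <- descents a].
Proof.
case: a => // x s _; rewrite /descents -map_comp /=;
  apply/eq_in_map => -[|i] //=.
by rewrite mem_iota.
Qed.

Lemma descents_gt0 n a : a \in compositions n -> 0%N \notin descents a.
Proof.
rewrite mem_compositions => /andP[+ _]; case: a => // x s /= /andP[x0 _].
by apply/mapP => -[[|i]]; rewrite mem_iota //=; case: x x0.
Qed.

Lemma compositions_neq_nil n a : a \in compositions n.+1 -> a != [::].
Proof. by apply: contraTneq => ->; rewrite mem_compositions. Qed.

Lemma uniq_descents n a : a \in compositions n -> uniq (descents a).
Proof.
elim: a n => // x [|y s] IH n //; rewrite compositions_cons descents_cons //.
case/and3P=> x0 _ sC; rewrite cons_uniq map_inj_uniq ?(IH _ sC) ?andbT;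
  last exact: addnI.
apply/mapP => -[i iD /eqP]; rewrite -{1}[x]addn0 eqn_add2l => /eqP i0.
by have := descents_gt0 sC; rewrite i0 iD.
Qed.

(** Descents are distinct and one fewer than the parts. The bound keeps the subtraction in the sign
    of [flag_h] from being truncated. *)
Lemma refines_size n a b : a \in compositions n -> b \in compositions n ->
  refines b a -> (size b <= size a)%N.
Proof.
move=> aC bC /allP ba; have := uniq_leq_size (uniq_descents bC) ba.
rewrite !size_map !size_iota; case: b bC {ba} => // x b bC; case: a aC => //.
case: n bC => [|n]; first by rewrite compositions0.
by move=> _ /compositions_neq_nil.
Qed.

(** * Words attached to descent sets *)

Section Words.
Variable R : pzRingType.
Variables u v : R.

(** The letters are arbitrary ring elements because [ab_word] is needed also with [a] replaced by
    [a - b]. *)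
Definition word n D : R := \prod_(1 <= i < n) (if i \in D then u else v).

Lemma word_nil n : word n [::] = v ^+ n.-1.
Proof. by rewrite /word big_const_nat subn1 iter_mulr mulr1. Qed.

(** The positions before [x] give [v ^+ x.-1], position [x] gives [u], and the later ones form the
    word of [D] shifted by [x]. *)
Lemma word_cons x n D : (0 < x)%N -> 0%N \notin D ->
  word (x + n.+1) (x :: [seq (x + i)%N | i <- D]) = v ^+ x.-1 * u * word n.+1 D.
Proof.
move=> x0 D0; rewrite /word (big_cat_nat (n := x)) ?leq_addr //= -mulrA.
rewrite [X in _ * X]big_ltn ?mem_head; last by rewrite addnS ltnS leq_addr.
congr (_ * (_ * _)).
  rewrite -subn1 -prodr_const_nat; apply: eq_big_nat => i /andP[_ ix].
  rewrite inE ltn_eqF //=; case: mapP => // -[j _ ij].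
  by rewrite ij ltnNge leq_addr in ix.
rewrite -[x.+1]addn1 addnC [(x + _)%N]addnC big_addn addnK.
apply: eq_big_nat => i /andP[i0 _]; rewrite inE [(i + x)%N]addnC.
by rewrite -{2}[x]addn0 eqn_add2l eqn0Ngt i0 /= mem_map //; exact: addnI.
Qed.

Lemma word_succ n D : 0%N \notin D ->
  word n.+2 [seq i.+1 | i <- D] = v * word n.+1 D.
Proof.
move=> D0; rewrite /word big_ltn // big_add1 /=; congr (_ * _).
  by case: mapP => // -[j + [j0]]; rewrite -j0 (negbTE D0).
by apply: eq_bigr => i _; rewrite mem_map //; exact: succn_inj.
Qed.

Lemma compositions1 : compositions 1 = [:: [:: 1%N]].
Proof.
apply: perm_small_eq => //; apply: uniq_perm;
  rewrite ?uniq_compositions // => -[|x s].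
  by rewrite mem_compositions.
rewrite compositions_cons inE; case: x => [|[|x]] //=.
by rewrite compositions0 inE.
Qed.

(** In this and the next three lemmas, 1 is a descent after prepending 1 and is none after
    [incr_head], while all old descents shift by one. *)
Lemma refines_cons1 n a b : a \in compositions n.+1 ->
  b \in compositions n.+1 ->
  refines (1%N :: b) (1%N :: a) = refines b a.
Proof.
move=> aC bC; rewrite /refines !descents_cons ?(compositions_neq_nil aC) //.
  rewrite /= all_map; apply: eq_in_all => i /= iD.
  rewrite inE mem_map; last exact: addnI.
  by case: i iD => // iD; rewrite -(negbK (0%N \in _)) (descents_gt0 bC) in iD.
exact: compositions_neq_nil bC.
Qed.

Lemma refines_cons1_incr_head n a b : a \in compositions n.+1 ->
  b \in compositions n.+1 -> refines (1%N :: b) (incr_head a) = false.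
Proof.
move=> aC bC; rewrite /refines descents_cons ?(compositions_neq_nil bC) //=.
rewrite descents_incr_head ?(compositions_neq_nil aC) //.
by rewrite (mem_map succn_inj) (negbTE (descents_gt0 aC)).
Qed.

Lemma refines_incr_head_cons1 n a b : a \in compositions n.+1 ->
  b \in compositions n.+1 -> refines (incr_head b) (1%N :: a) = refines b a.
Proof.
move=> aC bC; rewrite /refines descents_cons ?(compositions_neq_nil aC) //=.
rewrite descents_incr_head ?(compositions_neq_nil bC) // all_map.
apply: eq_in_all => i /= iD; rewrite inE mem_map; last exact: addnI.
by case: i iD => // iD; rewrite -(negbK (0%N \in _)) (descents_gt0 bC) in iD.
Qed.

Lemma refines_incr_head n a b : a \in compositions n.+1 ->
  b \in compositions n.+1 -> refines (incr_head b) (incr_head a) = refines b a.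
Proof.
move=> aC bC; rewrite /refines !descents_incr_head ?(compositions_neq_nil aC)
  //.
  by rewrite all_map; apply: eq_all => i /=; rewrite mem_map //;
    exact: succn_inj.
exact: compositions_neq_nil bC.
Qed.

Lemma word_cons1 n a : a \in compositions n.+1 ->
  word n.+2 (descents (1%N :: a)) = u * word n.+1 (descents a).
Proof.
move=> aC; rewrite descents_cons ?(compositions_neq_nil aC) //.
by rewrite -[n.+2]add1n (word_cons n (ltn0Sn 0) (descents_gt0 aC)) expr0 mul1r.
Qed.

Lemma word_incr_head n a : a \in compositions n.+1 ->
  word n.+2 (descents (incr_head a)) = v * word n.+1 (descents a).
Proof.
move=> aC; rewrite descents_incr_head ?(compositions_neq_nil aC) //.
exact: word_succ (descents_gt0 aC).
Qed.

End Words.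

Lemma size_incr_head n a : a \in compositions n.+1 ->
  size (incr_head a) = size a.
Proof. by case: a => // /compositions_neq_nil. Qed.

Lemma compositionsS_ind n (P : seq nat -> Prop) :
  (forall a, a \in compositions n.+1 -> P (1%N :: a)) ->
  (forall a, a \in compositions n.+1 -> P (incr_head a)) ->
  forall a, a \in compositions n.+2 -> P a.
Proof.
move=> P1 P2 [|x s]; first by rewrite mem_compositions.
case: x => [|[|x]]; rewrite compositions_cons //= ?subSS ?subn0;
  first exact: P1.
move=> /andP[xn sC]; apply: (P2 (x.+1 :: s)).
by rewrite compositions_cons /= -ltnS xn.
Qed.

(** A composition refined by [b] is [b] with further descents, each costing a sign. Independently at
    every position outside the descents of [b], the choice is between [v] and [- u], which sums to
    [v - u]. *)
Lemma sum_refines_word (R : pzRingType) (u v : R) n b :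
  b \in compositions n.+1 ->
  \sum_(a <- compositions n.+1 | refines b a)
    (-1) ^+ (size a + size b) * word u v n.+1 (descents a) =
  word u (v - u) n.+1 (descents b).
Proof.
elim: n b => [|n IH] b.
  rewrite compositions1 inE => /eqP ->.
  by rewrite big_cons big_nil /= addr0 /word !big_geq // sqrrN expr1n mulr1.
(* The induction treats position 1: if it is a descent of [b], it is one of [a]; otherwise both
   choices for [a] contribute. *)
rewrite big_mkcond sum_compositionsS; move: b; apply: compositionsS_ind => b bC.
  rewrite word_cons1 // -IH // mulr_sumr [RHS]big_mkcond.
  apply: eq_big_seq => a aC /=; rewrite (refines_cons1_incr_head aC bC) addr0.
  rewrite (refines_cons1 aC bC); case: ifP => // _.
  rewrite word_cons1 // addSn addnS !exprS !mulN1r opprK.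
  by rewrite !mulrA; congr (_ * _); exact/esym/commr_sign.
rewrite word_incr_head // -IH // mulr_sumr [RHS]big_mkcond.
apply: eq_big_seq => a aC.
rewrite (refines_incr_head_cons1 aC bC) (refines_incr_head aC bC).
case: ifP => _; last exact: addr0.
rewrite word_cons1 // word_incr_head // (size_incr_head aC) (size_incr_head bC).
rewrite addSn exprS mulN1r mulNr mulrBl addrC.
by rewrite !mulrA; congr (_ * _ - _ * _); exact/esym/commr_sign.
Qed.

End Compositions.

(** * The ab-index *)

Section ABIndex.
Variables (T : finType) (B : {set {set T}}).
Implicit Types (Y J : {set T}).

(** Exchanging the sums over [a] and [b] leaves, for each [b], the sum computed in
    [sum_refines_word]. *)
Lemma ab_index_word Y : Y != set0 ->
  ab_index Y B = \sum_(b <- compositions #|Y|)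
    (zeta b Y B)%:R *: word vb (va - vb) #|Y| (descents b).
Proof.
rewrite -card_gt0 /ab_index /flag_h; case: #|Y| => // n _.
under eq_bigr => a _ do rewrite rmorph_sum scaler_suml big_mkcond.
rewrite exchange_big; apply: eq_big_seq => b bC.
rewrite -big_mkcond -sum_refines_word // scaler_sumr.
rewrite big_seq_cond [RHS]big_seq_cond; apply: eq_bigr => a /andP[aC ba].
rewrite rmorphM rmorphXn /= rmorphN1 -pmulrn -[in LHS]signr_odd.
(* As [size b <= size a], the difference and the sum of the sizes have the same parity. *)
rewrite oddB ?(refines_size aC bC ba) // -oddD -[in RHS]signr_odd.
by case: (odd _); rewrite ?expr1 ?expr0 ?mulN1r ?mul1r ?scaleNr ?scalerN.
Qed.

(** Here [J] is the first block. It contributes [|J| - 1] letters [a - b], followed by [b] and the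
    word of the rest, unless nothing is left. *)
Lemma ab_index_rec Y : Y != set0 ->
  ab_index Y B = \sum_(J : {set T} | (J \subset Y) && (J != set0))
    (discrete_on B J)%:R *: ((va - vb) ^+ #|J|.-1 *
      ((Y == J)%:R + vb * (if Y :\: J == set0 then 0 else ab_index (Y :\: J)
        B))).
Proof.
move=> Y0; rewrite ab_index_word //.
have Yn : #|Y| = #|Y|.-1.+1 by rewrite prednK // card_gt0.
rewrite Yn sum_compositions_cons -Yn.
(* The contribution of the decompositions with first block [J]. *)
pose K J := \sum_(s <- compositions (#|Y| - #|J|))
  (zeta s (Y :\: J) B)%:R *: word vb (va - vb) #|Y| (descents (#|J| :: s)).
transitivity (\sum_(1 <= x < #|Y|.+1)
  \sum_(J : {set T} | ((J \subset Y) && discrete_on B J) && (x == #|J|)) K J).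
  apply: eq_bigr => x _.
  under eq_bigr do rewrite zeta_cons natr_sum scaler_suml.
  rewrite exchange_big; apply: eq_big => [J|J /and3P[_ _ /eqP <-] //].
  by rewrite andbA eq_sym.
rewrite (exchange_big_dep (fun J : {set T} =>
  (J \subset Y) && discrete_on B J)) /=; last first.
  by move=> x J _ /andP[].
rewrite [RHS]big_mkcondr [LHS]big_mkcondr; apply: eq_bigr => J JY.
case: (boolP (discrete_on B J)) => dJ; last by rewrite scale0r if_same.
under eq_bigl => x do rewrite JY /=.
(* Only [x = |J|] survives, and the lower bound [1 <= x] excludes the empty block. *)
rewrite big_nat1_eq ltnS subset_leq_card // andbT card_gt0.
case: ifP => // J0; rewrite scale1r /K.
have [YJ|YJ] := eqVneq (Y :\: J) set0.
  have -> : J = Y by apply/eqP; rewrite eqEsubset JY -setD_eq0 YJ eqxx.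
  rewrite eqxx mulr0 addr0 mulr1 subnn compositions0 big_seq1.
  by rewrite setDv zeta_nil eqxx scale1r word_nil.
have nYJ : Y == J = false by apply: contraNF YJ => /eqP ->; rewrite setDv.
rewrite nYJ add0r ab_index_word // mulrA mulr_sumr.
have cYJ : #|Y :\: J| = (#|Y| - #|J|)%N by rewrite cardsD (setIidPr JY).
rewrite -cYJ; apply: eq_big_seq => s sC; rewrite -rat_scalerAr; congr (_ *: _).
have Yp : #|Y :\: J| = #|Y :\: J|.-1.+1 by rewrite prednK // card_gt0.
rewrite Yp in sC *; rewrite -word_cons ?card_gt0 ?J0 ?(descents_gt0 sC) //.
rewrite descents_cons ?(compositions_neq_nil sC) // -Yp cYJ subnKC //.
exact: subset_leq_card.
Qed.

End ABIndex.

Theorem theorem7 (T : finType) (X : {set T}) (B : {set {set T}}) :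
  building_set X B -> eulerian X B ->
  exists Phi : ncpoly2,
    ab_index X B = nceval (va + vb) (va * vb + vb * va) Phi.
Proof.
move=> [BX _ _] eB; have B0 : set0 \notin B by apply/negP => /BX[];
  rewrite eqxx.
(* On the empty ground set all words are empty and the ab-index is a scalar. *)
have [->|X0] := eqVneq X set0.
  apply: nceval_image_sum => a _; apply: nceval_imageZ.
  by rewrite /ab_word cards0 big_geq //; exact: nceval_image1.
(* The ab-index of the empty set is 1, but the recursion requires 0 there: the case [J = Y] is
   already covered by its separate term. *)
pose Psi Y := if Y == set0 then 0 else ab_index Y B.
have -> : ab_index X B = Psi X by rewrite /Psi (negbTE X0).
apply: (nceval_image_Psi (X := X) (z := fun J => (discrete_on B J)%:R)) => //.
- by rewrite discrete_on0.
- by move=> Y YX Y0; apply: eulerian_odd eB YX Y0.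
move=> Y YX; rewrite {1}/Psi; case: eqP => [->|/eqP Y0];
  last exact: ab_index_rec.
by rewrite big1 // => J; rewrite subset0 => /andP[->].
Qed.
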